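(* Let $\gamma_1,\dots,\gamma_g$ be free generators, in good position, of a Schottky group $\Gamma\le PGL(2,K)$, with a corresponding good fundamental domain $F=\mathbb{P}^1\setminus(B_1\cup\dots\cup B_g\cup B_1'\cup\dots\cup B_g')$. Let $c$ be the smallest pairwise distance in $(\mathbb{P}^1)^{an}$ between the $2g$ points $P_1,\dots,P_g,P_1',\dots,P_g'$ corresponding to the closed balls $B_1^+,\dots,B_g^+,B_1'^+,\dots,B_g'^+$. Let $m\ge 1$ be an integer and let $1\le i,j\le g$. If $a\in B_i'^+\setminus B_i'$ and $z\in B_j'^+\setminus B_j'$ with $a\ne z$, then $$\left|\frac{\Theta_m(a,\gamma_i a;z)/\Theta_m(a,\gamma_i a;\gamma_j z)}{\Theta(a,\gamma_i a;z)/\Theta(a,\gamma_i a;\gamma_j z)}-1\right|\le p^{-cm}.$$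
   Context: $K=\mathbb{C}_p$ is the completion of an algebraic closure of $\mathbb{Q}_p$, with norm normalized by $|p|=1/p$, and $\mathbb{P}^1=\mathbb{P}^1(K)=K\cup\{\infty\}$, on which $PGL(2,K)$ acts by fractional linear transformations. Schottky groups: a $2\times2$ matrix is hyperbolic if it has two eigenvalues with different valuations. A Schottky group is a finitely generated subgroup $\Gamma\le PGL(2,K)$ all of whose non-identity elements are hyperbolic; such a group is free. With respect to free generators $\gamma_1,\dots,\gamma_g$, each $\gamma\in\Gamma$ has a unique reduced word $\gamma=h_1\cdots h_k$ with $h_l\in\{\gamma_1^{\pm1},\dots,\gamma_g^{\pm1}\}$ and $h_l\neq h_{l+1}^{-1}$; $k$ is its length. $\Gamma_m$ is the set of elements of $\Gamma$ with reduced word of length at most $m$. Balls: for $a\in K$, $r>0$ let $B(a,r)=\{x\in K:|x-a|<r\}$ and $B(a,r)^+=\{x\in K:|x-a|\le r\}$. An open ball in $\mathbb{P}^1$ is some $B(a,r)$ or some $\mathbb{P}^1\setminus B(a,r)^+$. The corresponding closed ball $B^+$ of an open ball $B$ is $B(a,r)^+$ if $B=B(a,r)$, and $\mathbb{P}^1\setminus B(a,r)$ if $B=\mathbb{P}^1\setminus B(a,r)^+$. A good fundamental domain corresponding to $\gamma_1,\dots,\gamma_g$ is $F=\mathbb{P}^1\setminus(B_1\cup\dots\cup B_g\cup B_1'\cup\dots\cup B_g')$ with $B_i,B_i'$ open balls such that the $2g$ corresponding closed balls $B_i^+,B_i'^+$ are pairwise disjoint and $\gamma_i(\mathbb{P}^1\setminus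 B_i')=B_i^+$, $\gamma_i^{-1}(\mathbb{P}^1\setminus B_i)=B_i'^+$ for all $i$. The generators are in good position if such a domain exists. Points and distance in the analytic projective line $(\mathbb{P}^1)^{an}$: each closed ball $B(a,r)^+$ with $r>0$ determines a point (of Type 2 or 3) of $(\mathbb{P}^1)^{an}$; the point corresponding to a closed ball $\mathbb{P}^1\setminus B(a,r)$ is the point determined by $B(a,r)^+$. If $B(a_1,r_1)^+\subseteq B(a_2,r_2)^+$ determine $P_1,P_2$, then $d(P_1,P_2)=\log_p(r_2/r_1)$; in general $d(P_1,P_2)=d(P_1,P_3)+d(P_3,P_2)$, where $P_3$ is determined by the smallest closed ball $B(a_3,r_3)^+$ containing both. Theta functions: $\Theta(a,b;z)=\prod_{\gamma\in\Gamma}\frac{z-\gamma a}{z-\gamma b}$ and $\Theta_m(a,b;z)=\prod_{\gamma\in\Gamma_m}\frac{z-\gamma a}{z-\gamma b}$. The quotient $\Theta(a,\gamma_i a;z)/\Theta(a,\gamma_i a;\gamma_j z)$ is understood as the product over $\gamma\in\Gamma$ of the cross ratios $\frac{(z-\gamma a)(\gamma_j z-\gamma\gamma_i a)}{(z-\gamma\gamma_i a)(\gamma_j z-\gamma a)}$, and likewise for $\Theta_m$ with the product over $\Gamma_m$ (with the usual convention for cross ratios when one of the points is $\infty$). *)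

(* Defs.v *)
From HB Require Import structures.
From mathcomp Require Import all_boot all_order all_algebra finmap.
From mathcomp Require Import all_classical all_reals interval_inference exp.

Set Implicit Arguments.
Unset Strict Implicit.
Unset Printing Implicit Defensive.

Import Order.TTheory GRing.Theory Num.Theory.

Local Open Scope classical_set_scope.
Local Open Scope ring_scope.
Local Open Scope quotient_scope.

Section Cp.
Variables (R : realType) (p : nat) (K : fieldType) (nu : K -> R).

Record nonarch_absval : Prop := NonarchAbsval {
  absval_ge0 : forall x, 0 <= nu x;
  absval_eq0 : forall x, nu x = 0 <-> x = 0;
  absvalM : forall x y, nu (x * y) = nu x * nu y;
  absvalD : forall x y, nu (x + y) <= Num.max (nu x) (nu y)
}.

Definition abs_cauchy (u : nat -> K) : Prop :=
  forall e : R, 0 < e ->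
  exists N, forall m n, (N <= m)%N -> (N <= n)%N -> nu (u m - u n) < e.

Definition abs_cvg (u : nat -> K) (l : K) : Prop :=
  forall e : R, 0 < e -> exists N, forall n, (N <= n)%N -> nu (u n - l) < e.

Definition abs_complete : Prop :=
  forall u, abs_cauchy u -> exists l, abs_cvg u l.

Definition abs_closure (A : set K) : set K :=
  [set x | forall e : R, 0 < e -> exists2 y, A y & nu (x - y) < e].

(* In a complete K with |p| = 1/p, the absolute value induced on the prime
   field is the p-adic one, so the closure of the prime field is the completion
   Q_p of Q. *)
Definition Qp_in : set K := abs_closure (range (@ratr K)).

Definition Qpbar_in : set K :=
  [set x | exists P : {poly K},
     [/\ P != 0, forall i, Qp_in P`_i & root P x]].

(* (K, nu) is a completion of an algebraic closure of Q_p; this determines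
   (K, nu) up to isometric isomorphism. *)
Record is_Cp : Prop := IsCp {
  Cp_absval : nonarch_absval;
  Cp_normp : nu p%:R = p%:R^-1;
  Cp_complete : abs_complete;
  Cp_algclosed : forall P : {poly K}, (forall i, Qpbar_in P`_i) ->
    (1 < size P)%N -> exists2 x, Qpbar_in x & root P x;
  Cp_dense : abs_closure Qpbar_in = setT
}.

End Cp.

Definition GL2 (K : fieldType) := {A : 'M[K]_2 | A \in unitmx}.

Section PGL2.
Variable K : fieldType.
Local Notation GL2 := (GL2 K).

Definition projeq (A B : GL2) : bool :=
  `[< exists2 k : K, k != 0 & sval A = k *: sval B >].

Lemma projeq_refl : reflexive projeq.
Proof. by move=> A; apply/asboolP; exists 1; rewrite ?oner_neq0 ?scale1r. Qed.

Lemma projeq_sym : symmetric projeq.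
Proof.
suff H A B : projeq A B -> projeq B A by move=> A B; apply/idP/idP; apply: H.
move=> /asboolP[k k0 AB]; apply/asboolP; exists k^-1; first by rewrite invr_neq0.
by rewrite AB scalerA mulVf// scale1r.
Qed.

Lemma projeq_trans : transitive projeq.
Proof.
move=> B A C /asboolP[k k0 AB] /asboolP[l l0 BC]; apply/asboolP.
by exists (k * l); rewrite ?mulf_neq0// AB BC scalerA.
Qed.

Canonical projeq_equiv := EquivRel projeq projeq_refl projeq_sym projeq_trans.

Definition PGL2 := {eq_quot projeq}.
HB.instance Definition _ := Choice.on PGL2.
HB.instance Definition _ := EqQuotient.on PGL2.

Lemma GL2_mul_subproof (A B : GL2) : sval A *m sval B \in unitmx.
Proof. by rewrite unitmx_mul (svalP A) (svalP B). Qed.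

Lemma GL2_inv_subproof (A : GL2) : invmx (sval A) \in unitmx.
Proof. by rewrite unitmx_inv (svalP A). Qed.

Definition GL2_mul (A B : GL2) : GL2 :=
  exist (fun C : 'M[K]_2 => C \in unitmx) _ (GL2_mul_subproof A B).
Definition GL2_inv (A : GL2) : GL2 :=
  exist (fun C : 'M[K]_2 => C \in unitmx) _ (GL2_inv_subproof A).
Definition GL2_one : GL2 :=
  exist (fun C : 'M[K]_2 => C \in unitmx) 1%:M (unitmx1 K 2).

Definition PGL2_mul (x y : PGL2) : PGL2 := \pi_PGL2 (GL2_mul (repr x) (repr y)).
Definition PGL2_inv (x : PGL2) : PGL2 := \pi_PGL2 (GL2_inv (repr x)).
Definition PGL2_one : PGL2 := \pi_PGL2 GL2_one.

Lemma projeqP (A B : GL2) :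
  reflect (exists2 k : K, k != 0 & sval A = k *: sval B)
          (\pi_PGL2 A == \pi_PGL2 B).
Proof. by rewrite eqmodE; apply: asboolP. Qed.

Lemma repr_piP (A : GL2) :
  exists2 k : K, k != 0 & sval (repr (\pi_PGL2 A)) = k *: sval A.
Proof. by apply/projeqP; rewrite reprK. Qed.

Lemma PGL2_mul_pi (A B : GL2) :
  PGL2_mul (\pi_PGL2 A) (\pi_PGL2 B) = \pi_PGL2 (GL2_mul A B).
Proof.
apply/eqP/projeqP; have [k k0 kA] := repr_piP A; have [l l0 lB] := repr_piP B.
exists (k * l); first by rewrite mulf_neq0.
by rewrite /= kA lB -scalemxAl -scalemxAr scalerA.
Qed.

Lemma PGL2_inv_pi (A : GL2) : PGL2_inv (\pi_PGL2 A) = \pi_PGL2 (GL2_inv A).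
Proof.
apply/eqP/projeqP; have [k k0 kA] := repr_piP A.
exists k^-1; first by rewrite invr_neq0.
by rewrite /= kA invmxZ ?unitmxZ ?unitfE ?(svalP A).
Qed.

Lemma pi_sval (A B : GL2) : sval A = sval B -> \pi_PGL2 A = \pi_PGL2 B.
Proof. by move=> AB; rewrite (_ : A = B) //; apply: val_inj. Qed.

Lemma pi_surj (x : PGL2) : exists A, x = \pi_PGL2 A.
Proof. by exists (repr x); rewrite reprK. Qed.

Lemma PGL2_mulA : associative PGL2_mul.
Proof.
move=> x y z; have [A ->] := pi_surj x; have [B ->] := pi_surj y.
have [C ->] := pi_surj z; rewrite !PGL2_mul_pi.
by apply: pi_sval; rewrite /= mulmxA.
Qed.

Lemma PGL2_mul1 : left_id PGL2_one PGL2_mul.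
Proof.
move=> x; have [A ->] := pi_surj x; rewrite PGL2_mul_pi.
by apply: pi_sval; rewrite /= mul1mx.
Qed.

Lemma PGL2_mulr1 : right_id PGL2_one PGL2_mul.
Proof.
move=> x; have [A ->] := pi_surj x; rewrite PGL2_mul_pi.
by apply: pi_sval; rewrite /= mulmx1.
Qed.

Lemma PGL2_mulV : left_inverse PGL2_one PGL2_inv PGL2_mul.
Proof.
move=> x; have [A ->] := pi_surj x; rewrite PGL2_inv_pi PGL2_mul_pi.
by apply: pi_sval; rewrite /= mulVmx ?(svalP A).
Qed.

Lemma PGL2_mulrV : right_inverse PGL2_one PGL2_inv PGL2_mul.
Proof.
move=> x; have [A ->] := pi_surj x; rewrite PGL2_inv_pi PGL2_mul_pi.
by apply: pi_sval; rewrite /= mulmxV ?(svalP A).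
Qed.

HB.instance Definition _ := isGroup.Build PGL2
  PGL2_mulA PGL2_mul1 PGL2_mulr1 PGL2_mulV PGL2_mulrV.

(* [None] is the point at infinity. *)
Definition P1 := option K.

Definition mobmx (A : 'M[K]_2) (x : P1) : P1 :=
  let: (u, w) := if x is Some t then (A 0 0 * t + A 0 1, A 1 0 * t + A 1 1)
                 else (A 0 0, A 1 0) in
  if w == 0 then None else Some (u / w).

Definition mob (h : PGL2) (x : P1) : P1 := mobmx (sval (repr h)) x.

Lemma mobmxZ (k : K) (A : 'M[K]_2) (x : P1) :
  k != 0 -> mobmx (k *: A) x = mobmx A x.
Proof.
move=> k0; case: x => [t|]; rewrite /mobmx !mxE.
  rewrite -!mulrA -!mulrDr mulf_eq0 (negPf k0) /=; case: eqP => // _.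
  by rewrite -mulf_div divff// mul1r.
rewrite mulf_eq0 (negPf k0) /=; case: eqP => // _.
by rewrite -mulf_div divff// mul1r.
Qed.

Lemma mob_pi (A : GL2) (x : P1) : mob (\pi_PGL2 A) x = mobmx (sval A) x.
Proof. by rewrite /mob; have [k k0 ->] := repr_piP A; rewrite mobmxZ. Qed.

(* Cross ratio (z-a)(w-b) / ((z-b)(w-a)): the two differences involving the
   point at infinity cancel, so each is replaced by 1. *)
Definition P1_sub (x y : P1) : K :=
  match x, y with
  | Some s, Some t => s - t
  | None, None => 0
  | _, _ => 1
  end.

Definition cross_ratio (z w a b : P1) : K :=
  (P1_sub z a * P1_sub w b) / (P1_sub z b * P1_sub w a).

End PGL2.

Section Schottky.
Variables (R : realType) (K : fieldType) (nu : K -> R).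

(* Eigenvalues of a class are only defined up to a common scalar, which does
   not affect the condition. *)
Definition hyperbolic (h : PGL2 K) : Prop :=
  exists a b, [/\ eigenvalue (sval (repr h)) a, eigenvalue (sval (repr h)) b
                & nu a <> nu b].

Definition subgroup_set (H : set (PGL2 K)) : Prop := group_closed (mem H).

Definition finitely_generated (H : set (PGL2 K)) : Prop :=
  exists2 S : set (PGL2 K), finite_set S & H = smallest subgroup_set S.

Definition schottky (Gam : set (PGL2 K)) : Prop :=
  [/\ subgroup_set Gam, finitely_generated Gam
    & forall h, Gam h -> h <> 1%g -> hyperbolic h].

Variables (g : nat) (gam : 'I_g -> PGL2 K).

(* The letter (i, false) stands for gam i, and (i, true) for its inverse. *)
Definition letter : Type := ('I_g * bool)%type.

Definition letter_val (l : letter) : PGL2 K :=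
  if l.2 then (gam l.1)^-1%g else gam l.1.

Definition word_val (w : seq letter) : PGL2 K := (\prod_(l <- w) letter_val l)%g.

Definition reduced (w : seq letter) : bool :=
  sorted (fun l l' : letter => l != (l'.1, ~~ l'.2)) w.

Definition free_generators (Gam : set (PGL2 K)) : Prop :=
  Gam = smallest subgroup_set (range gam) /\
  (forall w, reduced w -> word_val w = 1%g -> w = [::]).

(* Gamma_m *)
Definition word_ball (m : nat) : set (PGL2 K) :=
  [set h | exists w, [/\ reduced w, (size w <= m)%N & word_val w = h]].

End Schottky.

Section Balls.
Variables (R : realType) (K : fieldType) (nu : K -> R).

(* A centre and a (positive) radius. *)
Definition disc : Type := (K * {posnum R})%type.

Definition radius (D : disc) : R := (D.2)%:num.

Definition disc_open (D : disc) : set K := [set x | nu (x - D.1) < radius D].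
Definition disc_closed (D : disc) : set K := [set x | nu (x - D.1) <= radius D].

Inductive oball : Type :=
  | Inner of disc   (* B(a,r) *)
  | Outer of disc.  (* P^1 \ B(a,r)^+ *)

Definition oball_set (B : oball) : set (P1 K) :=
  match B with
  | Inner D => Some @` disc_open D
  | Outer D => ~` (Some @` disc_closed D)
  end.

(* B^+ *)
Definition oball_closed (B : oball) : set (P1 K) :=
  match B with
  | Inner D => Some @` disc_closed D
  | Outer D => ~` (Some @` disc_open D)
  end.

(* The point of (P^1)^an corresponding to B^+, given by a disc D whose closed
   ball determines it. *)
Definition oball_point (B : oball) : disc :=
  match B with Inner D => D | Outer D => D end.

Definition smallest_disc (D1 D2 D3 : disc) : Prop :=
  [/\ disc_closed D1 `<=` disc_closed D3, disc_closed D2 `<=` disc_closed D3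
    & forall E, disc_closed D1 `<=` disc_closed E ->
        disc_closed D2 `<=` disc_closed E -> disc_closed D3 `<=` disc_closed E].

Definition disc_join (D1 D2 : disc) : disc := xget D1 (smallest_disc D1 D2).

Definition logp (p : nat) (x : R) : R := ln x / ln p%:R.

Definition an_dist (p : nat) (D1 D2 : disc) : R :=
  let D3 := disc_join D1 D2 in
  logp p (radius D3 / radius D1) + logp p (radius D3 / radius D2).

Variables (g : nat) (gam : 'I_g -> PGL2 K) (B B' : 'I_g -> oball).

(* The 2g balls: (i, false) is B_i and (i, true) is B'_i. *)
Definition all_balls (s : 'I_g * bool) : oball := if s.2 then B' s.1 else B s.1.

Definition good_fundamental_domain (F : set (P1 K)) : Prop :=
  [/\ F = ~` (\bigcup_s oball_set (all_balls s)),
      trivIset setT (fun s => oball_closed (all_balls s)),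
      forall i, mob (gam i) @` (~` oball_set (B' i)) = oball_closed (B i)
    & forall i, mob (gam i)^-1%g @` (~` oball_set (B i)) = oball_closed (B' i)].

Definition smallest_distance (p : nat) (c : R) : Prop :=
  (exists s t, s != t /\
     c = an_dist p (oball_point (all_balls s)) (oball_point (all_balls t))) /\
  (forall s t, s != t ->
     c <= an_dist p (oball_point (all_balls s)) (oball_point (all_balls t))).

End Balls.

Section Theta.
Variables (R : realType) (K : fieldType) (nu : K -> R).

(* Unconditional convergence of the product of f over A to l. *)
Definition has_prod (T : choiceType) (A : set T) (f : T -> K) (l : K) : Prop :=
  forall e : R, 0 < e -> exists2 S : {fset T}, [set` S] `<=` A &
    forall S' : {fset T}, [set` S] `<=` [set` S'] -> [set` S'] `<=` A ->
      nu (\prod_(x <- S') f x - l) < e.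

(* The value is 0 if the product does not converge. *)
Definition inf_prod (T : choiceType) (A : set T) (f : T -> K) : K :=
  xget 0 (has_prod A f).

Definition theta_factor (gi gj : PGL2 K) (a z : P1 K) (h : PGL2 K) : K :=
  cross_ratio z (mob gj z) (mob h a) (mob h (mob gi a)).

(* Theta(a, gi a; z) / Theta(a, gi a; gj z) *)
Definition theta_quot (Gam : set (PGL2 K)) (gi gj : PGL2 K) (a z : P1 K) : K :=
  inf_prod Gam (theta_factor gi gj a z).

(* Theta_m(a, gam_i a; z) / Theta_m(a, gam_i a; gam_j z) *)
Definition theta_quot_trunc (g : nat) (gam : 'I_g -> PGL2 K) (m : nat)
    (i j : 'I_g) (a z : P1 K) : K :=
  \big[*%R/1]_(h \in word_ball gam m) theta_factor (gam i) (gam j) a z h.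

End Theta.

(* Main.v *)
(* With [u = h a], [v = h (gam_i a)] and [w = gam_j z], the factor of [h] minus one
   is, up to sign, the cross ratio [(z - w)(u - v) / ((z - v)(w - u))].  Write [h]
   as a reduced word [h_1 ... h_k] with [k >= 2]: by ping-pong, [u] and [v] lie
   in the ball [h_1 ... h_(k-1) (B(h_k)^+)], the innermost of a chain of balls
   below [B(h_1)], while [z] and [w] lie outside [B(h_1)].  Consecutive balls of
   the chain are Moebius images of two distinct balls among the [2g] given ones,
   so each step multiplies the bound for this cross ratio by [q = p^(-c)], and
   the factor is within [q^(k-1)] of 1.  Hence all factors beyond [Gamma_m]
   together change the product by a relative error at most [q^m < 1]. *)
Require Import Defs.
From mathcomp Require Import all_boot all_order all_algebra finmap.
From mathcomp Require Import all_classical all_reals interval_inference exp.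
From mathcomp Require Import lra ring.

Set Implicit Arguments.
Unset Strict Implicit.
Unset Printing Implicit Defensive.

Import Order.TTheory GRing.Theory Num.Theory.

Local Open Scope classical_set_scope.
Local Open Scope ring_scope.

(** * Geometric sequences and nonarchimedean absolute values *)

Lemma exprn_lt_small (R : realType) (b e : R) :
  0 <= b -> b < 1 -> 0 < e -> exists n : nat, b ^+ n < e.
Proof.
rewrite le_eqVlt => /predU1P[<- _ e0|b0 b1 e0]; first by exists 1%N; rewrite expr1.
have h0 : 0 < b^-1 - 1 by rewrite subr_gt0 invf_gt1.
(* Bernoulli's inequality for [b^-1 > 1]: its powers are unbounded. *)
have bern n : 1 + n%:R * (b^-1 - 1) <= b^-1 ^+ n.
  elim: n => [|n IH]; first by rewrite mul0r addr0 expr0.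
  have n0 : 0 <= n%:R :> R by [].
  rewrite exprS -natr1; apply: le_trans (ler_wpM2l _ IH); last by rewrite invr_ge0 ltW.
  have : 0 <= n%:R * (b^-1 - 1) * (b^-1 - 1) by rewrite !mulr_ge0// ltW.
  by lra.
exists (Num.Def.archi_bound (e^-1 / (b^-1 - 1))).
set n := Num.Def.archi_bound _.
have : e^-1 / (b^-1 - 1) < n%:R.
  by apply: archi_boundP; rewrite divr_ge0// ?invr_ge0 ltW.
rewrite ltr_pdivrMr// => lt_n.
rewrite -ltf_pV2 ?posrE ?exprn_gt0// -exprVn.
apply: lt_le_trans (bern n).
by rewrite (lt_trans lt_n)// ltrDr.
Qed.

Section AbsoluteValue.
Variables (R : realType) (K : fieldType) (nu : K -> R).
Hypothesis nuP : nonarch_absval nu.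

Lemma nu_ge0 x : 0 <= nu x. Proof. by case: nuP. Qed.
Lemma nu0 : nu 0 = 0. Proof. by case: nuP => _ h _ _; apply/h. Qed.
Lemma nuM x y : nu (x * y) = nu x * nu y. Proof. by case: nuP. Qed.
Lemma nu_eq0 x : (nu x == 0) = (x == 0).
Proof. by case: nuP => _ h _ _; apply/eqP/eqP => /h. Qed.
Lemma nu_gt0 x : (0 < nu x) = (x != 0).
Proof. by rewrite lt_def nu_eq0 nu_ge0 andbT. Qed.
Lemma nu1 : nu 1 = 1.
Proof.
apply: (@mulfI _ (nu 1)); first by rewrite nu_eq0 oner_neq0.
by rewrite -nuM !mulr1.
Qed.
Lemma nuN x : nu (- x) = nu x.
Proof.
suff nuN1 : nu (-1) = 1 by rewrite -mulN1r nuM nuN1 mul1r.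
apply/eqP; rewrite -(@eqrXn2 _ 2) ?nu_ge0//.
by rewrite expr2 -nuM mulrNN mulr1 nu1 expr1n.
Qed.
Lemma nuB x y : nu (x - y) = nu (y - x).
Proof. by rewrite -nuN opprB. Qed.
Lemma nuV x : nu x^-1 = (nu x)^-1.
Proof.
have [->|x0] := eqVneq x 0; first by rewrite invr0 nu0 invr0.
apply: (@mulfI _ (nu x)); first by rewrite nu_eq0.
by rewrite -nuM divff// nu1 divff// nu_eq0.
Qed.
Lemma nuX x n : nu (x ^+ n) = nu x ^+ n.
Proof. by elim: n => [|n IH]; rewrite ?expr0 ?nu1// !exprS nuM IH. Qed.
Lemma nuD_le x y : nu (x + y) <= Num.max (nu x) (nu y).
Proof. by case: nuP. Qed.
Lemma nuB_le x y t : nu (x - y) <= Num.max (nu (x - t)) (nu (t - y)).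
Proof. by have := nuD_le (x - t) (t - y); rewrite addrA subrK. Qed.
Lemma nuD_eq x y : nu y < nu x -> nu (x + y) = nu x.
Proof.
move=> yx; apply/eqP; rewrite eq_le; apply/andP; split.
  by have := nuD_le x y; rewrite (max_idPl (ltW yx)).
have := nuD_le (x + y) (- y); rewrite addrK nuN.
by rewrite le_max => /orP[//|]; rewrite leNgt yx.
Qed.
Lemma nuB_eq x y t : nu (t - y) < nu (x - t) -> nu (x - y) = nu (x - t).
Proof. by move=> /nuD_eq; rewrite addrA subrK. Qed.

End AbsoluteValue.

(** * Density of the value group of [K] *)

Lemma Cp_absval_dense (R : realType) (p : nat) (K : fieldType) (nu : K -> R) :
  prime p -> is_Cp p nu -> forall r s : R, 0 <= r -> r < s ->
  exists x : K, r < nu x < s.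
Proof.
move=> p_pr KP.
have nuP := Cp_absval KP.
have p1 : 1 < p%:R :> R by rewrite ltr1n prime_gt1.
have p0 : 0 < p%:R :> R by rewrite (lt_trans ltr01).
have QpP (q : rat) : Qp_in nu (ratr q : K).
  by move=> e e0; exists (ratr q); [exists q|rewrite subrr nu0].
have root_p n : (0 < n)%N -> exists x : K, nu x ^+ n = p%:R^-1.
  move=> n0; have sP := size_XnsubC (p%:R : K) n0.
  have [||x _] := Cp_algclosed KP (P := 'X^n - (p%:R)%:P); last first.
  - rewrite rootE !hornerE subr_eq0 => /eqP xp; exists x.
    by rewrite -(nuX nuP) xp (Cp_normp KP).
  - by rewrite sP ltnS.
  - move=> i; exists ('X - (('X^n - (p%:R)%:P)`_i)%:P); split.
    + by rewrite polyXsubC_eq0.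
    + have QpX1 : Qp_in nu 1 by have := QpP 1; rewrite (ratr_int _ 1).
      have Qp0 : Qp_in nu 0 by have := QpP 0; rewrite (ratr_int _ 0).
      have QpE : exists z : int, ('X^n - (p%:R)%:P : {poly K})`_i = z%:~R.
        exists ((i == n)%:Z - (if i == 0%N then p%:Z else 0)).
        rewrite coefB coefXn coefC rmorphB /=.
        by case: (i == n); case: (i == 0%N).
      have [z ->] := QpE => k; rewrite coefB coefX coefC.
      have -> : (k == 1%N)%:R - (if k == 0%N then z%:~R else 0) =
        ratr ((k == 1%N)%:Z - (if k == 0%N then z else 0))%:~R :> K.
        by rewrite ratr_int rmorphB /=; case: (k == 1%N); case: (k == 0%N).
      exact: QpP.
    + by rewrite root_XsubC.
(* Choose [n] so that an [n]-th root [x] of [p] satisfies r/s < |x| < 1. Start from a negative power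
   [y] of [p] with |y| > s and multiply by [x] until the value first drops below [s]; the value
   before was at least [s], so the new one exceeds [r]. *)
have pos r s : 0 < r -> r < s -> exists x : K, r < nu x < s.
  move=> r0 rs; have s0 := lt_trans r0 rs.
  have [|||n] := @exprn_lt_small R (r / s) p%:R^-1; rewrite ?invr_gt0//.
  - by rewrite divr_ge0// ltW.
  - by rewrite ltr_pdivrMr// mul1r.
  move=> ltn.
  have n0 : (0 < n)%N.
    by case: n ltn => //; rewrite expr0 ltNge invf_le1// (ltW p1).
  have [x xn] := root_p n n0.
  have rx : r / s < nu x.
    have : (r / s) ^+ n < nu x ^+ n by rewrite xn.
    by rewrite ltr_pXn2r// ?nnegrE ?divr_ge0 ?nu_ge0// ltW.
  have x0 : 0 < nu x by rewrite (le_lt_trans _ rx)// divr_ge0// ltW.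
  have x1 : nu x < 1.
    rewrite -(expr_lt1 n0) ?nu_ge0// xn invf_lt1//.
  have [N Ns] : exists N, nu (p%:R : K) ^+ N < s^-1.
    apply: exprn_lt_small; rewrite ?nu_ge0 ?invr_gt0// (Cp_normp KP).
    by rewrite invf_lt1.
  pose y : K := p%:R ^- N.
  have sy : s < nu y.
    by rewrite /y nuV// nuX// -ltf_pV2 ?invrK ?posrE// ?invr_gt0 exprn_gt0//
      (Cp_normp KP) invr_gt0.
  have y0 : 0 < nu y by rewrite (lt_trans s0).
  have [M] : exists M, nu x ^+ M < s / nu y.
    by apply: exprn_lt_small; rewrite ?nu_ge0// divr_gt0.
  rewrite ltr_pdivlMr// => hM.
  have ex : exists M, nu x ^+ M * nu y < s by exists M.
  case: (ex_minnP ex) => k hk kmin; exists (x ^+ k * y).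
  rewrite nuM// nuX// hk andbT.
  case: k hk kmin => [|k] hk kmin; first by rewrite expr0 mul1r (lt_trans rs).
  have : s <= nu x ^+ k * nu y by rewrite leNgt; apply/negP => /kmin; rewrite ltnn.
  move=> sk; rewrite exprS -mulrA.
  move: rx; rewrite ltr_pdivrMr// => /lt_le_trans; apply.
  by rewrite ler_pM2l.
move=> r s; rewrite le_eqVlt => /predU1P[<-|] s0; last exact: pos.
have [||x /andP[lx xs]] := pos (s / 2) s; [lra|lra|exists x].
by rewrite xs (lt_trans _ lx)// divr_gt0.
Qed.

(** * Moebius action in homogeneous coordinates *)

Section Mobius.
Variable K : fieldType.
Implicit Types (A B : 'M[K]_2) (x y : P1 K) (h : PGL2 K).

Definition hom_coord x : K * K := if x is Some t then (t, 1) else (1, 0).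

Definition of_hom (v : K * K) : P1 K :=
  if v.2 == 0 then None else Some (v.1 / v.2).

Definition act2 A (v : K * K) : K * K :=
  (A 0 0 * v.1 + A 0 1 * v.2, A 1 0 * v.1 + A 1 1 * v.2).

Lemma mobmxE A x : mobmx A x = of_hom (act2 A (hom_coord x)).
Proof. by case: x => [t|]; rewrite /act2 /= ?mulr1 ?mulr0 ?addr0. Qed.

Lemma of_homK (v : K * K) : v != (0, 0) -> exists2 k, k != 0 &
  v = (k * (hom_coord (of_hom v)).1, k * (hom_coord (of_hom v)).2).
Proof.
case: v => s t; rewrite xpair_eqE /of_hom /=; have [->|t0 _] := eqVneq t 0.
  by rewrite andbT => s0; exists s; rewrite ?mulr1 ?mulr0.
by exists t => //=; rewrite mulr1 mulrC divfK.
Qed.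

Lemma of_homZ (k s t : K) : k != 0 -> of_hom (k * s, k * t) = of_hom (s, t).
Proof.
by move=> k0; rewrite /of_hom/= mulf_eq0 (negPf k0) /= -mulf_div divff// mul1r.
Qed.

Lemma hom_coordK : cancel hom_coord of_hom.
Proof. by case=> [t|]; rewrite /of_hom /= ?oner_eq0 ?divr1 ?eqxx. Qed.

Lemma det2 A : \det A = A 0 0 * A 1 1 - A 0 1 * A 1 0.
Proof.
rewrite (expand_det_row _ 0) !big_ord_recl big_ord0 /cofactor !det_mx11 !mxE /=.
rewrite addr0 expr0 expr1 mul1r mulN1r mulrN.
by congr (_ * A _ _ - A _ _ * A _ _); apply/val_inj.
Qed.

(** Cramer's rule: the determinant times each coordinate is a combination of the coordinates of the
    image. *)
Lemma act2_neq0 A (v : K * K) : A \in unitmx -> v != (0, 0) -> act2 A v != (0, 0).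
Proof.
rewrite unitmxE unitfE det2; case: v => s t dA; apply: contra_neq => -[e1 e2].
have es : (A 0 0 * A 1 1 - A 0 1 * A 1 0) * s = 0.
  transitivity (A 1 1 * (A 0 0 * s + A 0 1 * t) - A 0 1 * (A 1 0 * s + A 1 1 * t)).
    by ring.
  by rewrite e1 e2 !mulr0 subrr.
have et : (A 0 0 * A 1 1 - A 0 1 * A 1 0) * t = 0.
  transitivity (A 0 0 * (A 1 0 * s + A 1 1 * t) - A 1 0 * (A 0 0 * s + A 0 1 * t)).
    by ring.
  by rewrite e1 e2 !mulr0 subrr.
by move/eqP: es; move/eqP: et; rewrite !mulf_eq0 (negPf dA) => /eqP-> /eqP->.
Qed.

Lemma hom_coord_neq0 x : hom_coord x != (0, 0).
Proof. by case: x => [t|]; rewrite xpair_eqE oner_eq0 ?andbF. Qed.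

Lemma hom_coord_mobmx A x : A \in unitmx -> exists2 k, k != 0 &
  act2 A (hom_coord x) =
    (k * (hom_coord (mobmx A x)).1, k * (hom_coord (mobmx A x)).2).
Proof.
by move=> uA; rewrite mobmxE; apply/of_homK/act2_neq0/hom_coord_neq0.
Qed.

Lemma mobmxM A B x : B \in unitmx -> mobmx (A *m B) x = mobmx A (mobmx B x).
Proof.
move=> uB; rewrite [in RHS]mobmxE.
have [k k0 kB] := hom_coord_mobmx x uB; rewrite -(@of_homZ k)//.
rewrite mobmxE; congr of_hom; move: kB; rewrite /act2 /= => -[e1 e2].
rewrite !mulrDr !(mulrCA k) -e1 -e2 !mxE !big_ord_recl !big_ord0.
rewrite (_ : lift _ _ = 1); last exact/val_inj.
by congr pair; ring.
Qed.

Lemma mobM h h' x : mob (h * h')%g x = mob h (mob h' x).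
Proof.
rewrite (_ : (h * h')%g = PGL2_mul h h')// /PGL2_mul mob_pi mobmxM//.
exact: (svalP (repr h')).
Qed.

Lemma mob1 x : mob 1%g x = x.
Proof.
rewrite (_ : 1%g = PGL2_one K)// mob_pi mobmxE -[RHS]hom_coordK.
by rewrite /act2 !mxE /= !mul1r !mul0r addr0 add0r; case: hom_coord.
Qed.

Lemma mobK h : cancel (mob h) (mob h^-1%g).
Proof. by move=> x; rewrite -mobM mulVg mob1. Qed.

Lemma P1_sub_eq0 x y : (P1_sub x y == 0) = (x == y).
Proof. by case: x y => [s|] [t|]; rewrite /= ?oner_eq0 ?eqxx ?subr_eq0. Qed.

End Mobius.

(** * Brackets of points and cross ratio inequalities *)

Section Bracket.
Variables (R : realType) (K : fieldType) (nu : K -> R).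
Hypothesis nuP : nonarch_absval nu.
Implicit Types (x y z w u v : P1 K) (h : PGL2 K) (S : set (P1 K)).

(** Up to sign, [P1_sub x y] is the determinant of the normalized homogeneous coordinates. The
    bracket is not an invariant distance; it is meaningful only in expressions homogeneous in each
    point. *)
Definition bracket x y : R := nu (P1_sub x y).

Lemma bracket_ge0 x y : 0 <= bracket x y. Proof. exact: nu_ge0. Qed.

Lemma bracketC x y : bracket x y = bracket y x.
Proof. by case: x y => [s|] [t|]; rewrite /bracket //= nuB. Qed.

Lemma bracket_gt0 x y : (0 < bracket x y) = (x != y).
Proof. by rewrite nu_gt0// P1_sub_eq0. Qed.

Lemma bracket_homE x y :
  bracket x y = nu ((hom_coord x).1 * (hom_coord y).2
                    - (hom_coord x).2 * (hom_coord y).1).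
Proof.
case: x y => [s|] [t|] /=;
  rewrite ?mulr1 ?mul1r ?mulr0 ?mul0r ?subr0 ?sub0r /bracket//= ?nuN//.
Qed.

(** This is the Pluecker relation (z-x)(w-y) - (z-y)(w-x) = (z-w)(x-y), which holds up to sign when
    some of the points are infinite. *)
Lemma nu_cross_ratio_sub1 z w x y : z != y -> w != x ->
  nu (cross_ratio z w x y - 1) * (bracket z y * bracket w x) =
    bracket z w * bracket x y.
Proof.
move=> zy wx; rewrite /bracket -!nuM//.
have d0 : P1_sub z y * P1_sub w x != 0 by rewrite mulf_neq0 ?P1_sub_eq0.
rewrite mulrBl mul1r /cross_ratio divfK// {d0 zy wx}.
case: z w x y => [z|] [w|] [x|] [y|] /=;
  rewrite ?(mul0r, mulr0, mul1r, mulr1, subr0, sub0r, subrr, nuN nuP)//;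
  by [congr nu; ring | rewrite -(nuN nuP); congr nu; ring].
Qed.

(** A matrix multiplies the determinant of two coordinate vectors by its own determinant, whose
    absolute value is [d]; renormalizing the image vector of [x] costs the factor [l x]. *)
Lemma bracket_mob h : exists (d : R) (l : P1 K -> R),
  [/\ 0 < d, forall x, 0 < l x &
    forall x y, l x * l y * bracket (mob h x) (mob h y) = d * bracket x y].
Proof.
pose A := sval (repr h); have uA : A \in unitmx := svalP (repr h).
have kP x := hom_coord_mobmx x uA.
exists (nu (\det A)), (fun x => nu (s2val (cid2 (kP x)))); split.
- by rewrite nu_gt0// -unitfE -unitmxE.
- by move=> x; case: cid2 => k /= k0 _; rewrite nu_gt0.
- move=> x y; case: cid2 => k k0; case: cid2 => k' k'0 /= [e1 e2] [e3 e4].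
  rewrite !bracket_homE -!nuM// det2; congr nu.
  transitivity ((k * (hom_coord (mobmx A x)).1) * (k' * (hom_coord (mobmx A y)).2)
    - (k * (hom_coord (mobmx A x)).2) * (k' * (hom_coord (mobmx A y)).1)).
    by rewrite /mob -/A; ring.
  by rewrite -e1 -e2 -e3 -e4; ring.
Qed.

(* For [z], [w], [u], [v] with nonzero denominators the inequality bounds by
   [rho] the absolute value of the cross ratio minus one. *)
Definition cross_le S (rho : R) u v : Prop := forall z w, S z -> S w ->
  bracket z w * bracket u v <= rho * (bracket z v * bracket w u).

(** Each of the four points occurs once on either side, so the factors [l] and [d] of [bracket_mob]
    cancel. *)
Lemma cross_le_mob h S rho u v : cross_le S rho u v ->
  cross_le (mob h @` S) rho (mob h u) (mob h v).
Proof.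
move=> H _ _ [z Sz <-] [w Sw <-].
have [d [l [d0 l0 lE]]] := bracket_mob h.
have L : 0 < l z * l w * (l u * l v) by rewrite !mulr_gt0.
rewrite -(ler_pM2l L).
have -> : l z * l w * (l u * l v) *
    (bracket (mob h z) (mob h w) * bracket (mob h u) (mob h v)) =
    (l z * l w * bracket (mob h z) (mob h w)) *
    (l u * l v * bracket (mob h u) (mob h v)) by ring.
have -> : l z * l w * (l u * l v) *
    (rho * (bracket (mob h z) (mob h v) * bracket (mob h w) (mob h u))) =
    rho * ((l z * l v * bracket (mob h z) (mob h v)) *
    (l w * l u * bracket (mob h w) (mob h u))) by ring.
rewrite !lE.
have -> : d * bracket z w * (d * bracket u v) =
  d * d * (bracket z w * bracket u v) by ring.
have -> : rho * (d * bracket z v * (d * bracket w u)) =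
  d * d * (rho * (bracket z v * bracket w u)) by ring.
by rewrite ler_pM2l ?mulr_gt0//; exact: H.
Qed.

End Bracket.

(** * Balls, distances of their points, and cross ratios *)

Section BallGeometry.
Variables (R : realType) (K : fieldType) (nu : K -> R).
Hypothesis nuP : nonarch_absval nu.
Hypothesis nu_dense : forall r s : R, 0 <= r -> r < s ->
  exists x : K, r < nu x < s.
Implicit Types (D : disc R K) (C : oball R K) (u v z w : P1 K).

Lemma oball_setE C z : oball_set nu C z =
  match C, z with
  | Inner D, Some t => nu (t - D.1) < radius D
  | Inner _, None => False
  | Outer D, Some t => radius D < nu (t - D.1)
  | Outer _, None => True
  end.
Proof.
apply/propext; case: C z => D [t|] /=.
- by split=> [[x + [<-]]|?]; last exists t.
- by split=> // -[].
- split=> [h|h [x + [e]]].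
    by rewrite ltNge; apply/negP => h'; apply: h; exists t.
  by rewrite /disc_closed/= e leNgt h.
- by split=> // _ [].
Qed.

Lemma oball_closedE C z : oball_closed nu C z =
  match C, z with
  | Inner D, Some t => nu (t - D.1) <= radius D
  | Inner _, None => False
  | Outer D, Some t => radius D <= nu (t - D.1)
  | Outer _, None => True
  end.
Proof.
apply/propext; case: C z => D [t|] /=.
- by split=> [[x + [<-]]|?]; last exists t.
- by split=> // -[].
- split=> [h|h [x + [e]]].
    by rewrite leNgt; apply/negP => h'; apply: h; exists t.
  by rewrite /disc_open/= e ltNge h.
- by split=> // _ [].
Qed.

Lemma oball_set_closed C : oball_set nu C `<=` oball_closed nu C.
Proof.
by move=> z; rewrite oball_setE oball_closedE; case: C z => D [t|] // /ltW.
Qed.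

Lemma radius_gt0 D : 0 < radius D. Proof. by rewrite /radius. Qed.

(* Density of the value group makes the radius a function of the closed disc. *)
Lemma le_radius D1 D2 :
  disc_closed nu D1 `<=` disc_closed nu D2 -> radius D1 <= radius D2.
Proof.
move=> sub; rewrite leNgt; apply/negP => lt21.
(* The point [x + D1.1] lies in the first disc, while the centres are at most [radius D2] apart, so
   its distance to [D2.1] is |x| > [radius D2]. *)
have [x /andP[x2 x1]] := nu_dense (ltW (radius_gt0 D2)) lt21.
have h1 : nu (D1.1 - D2.1) <= radius D2.
  by apply: sub; rewrite /disc_closed/= subrr nu0// ltW ?radius_gt0.
have : disc_closed nu D1 (x + D1.1) by rewrite /disc_closed/= addrK ltW.
by move=> /sub; rewrite /disc_closed/= -addrA nuD_eq ?(le_lt_trans h1)// leNgt x2.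
Qed.

Definition join_radius D1 D2 : R :=
  Num.max (nu (D1.1 - D2.1)) (Num.max (radius D1) (radius D2)).

Lemma join_radius_gt0 D1 D2 : 0 < join_radius D1 D2.
Proof. by rewrite /join_radius !lt_max radius_gt0 orbT. Qed.

(** [disc_join] picks one of many smallest discs, since every point of an ultrametric disc is a
    centre. Any two of them have the same closed set, so by [le_radius] the radius can be read off
    from the explicit [D3] centred at [D1.1]. *)
Lemma radius_disc_join D1 D2 : radius (disc_join nu D1 D2) = join_radius D1 D2.
Proof.
pose D3 : disc R K := (D1.1, PosNum (join_radius_gt0 D1 D2)).
have r3 : radius D3 = join_radius D1 D2 by [].
have S3 : smallest_disc nu D1 D2 D3.
  split=> [x|x|E]; rewrite /disc_closed/= ?r3.
  - by move=> h; rewrite /join_radius !le_max h /= orbT.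
  - move=> h; rewrite /join_radius !le_max.
    have := nuB_le nuP x D1.1 D2.1; rewrite le_max (nuB nuP D2.1) => /orP[|->//].
    by move=> /le_trans/(_ h) ->; rewrite !orbT.
  - move=> s1 s2 x /= h.
    have := nuB_le nuP x E.1 D1.1.
    have c1 : nu (D1.1 - E.1) <= radius E.
      by apply: s1; rewrite /= subrr nu0// ltW ?radius_gt0.
    have c2 : nu (D2.1 - E.1) <= radius E.
      by apply: s2; rewrite /= subrr nu0// ltW ?radius_gt0.
    move=> /le_trans; apply; rewrite ge_max c1 andbT (le_trans h)//.
    rewrite /join_radius !ge_max !le_radius// !andbT.
    by rewrite (le_trans (nuB_le nuP _ _ E.1))// ge_max c1 nuB.
have [] : smallest_disc nu D1 D2 (disc_join nu D1 D2).
  by apply: xgetPex; exists D3.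
case: S3 => s31 s32 min3 t1 t2 mint.
by rewrite -r3; apply/eqP; rewrite eq_le !le_radius//; [exact: min3|exact: mint].
Qed.

(** This is p^(-d) for the distance d between the two points of the analytic line. *)
Definition join_ratio D1 D2 : R := radius D1 * radius D2 / join_radius D1 D2 ^+ 2.

Lemma powR_an_dist (p : nat) D1 D2 : (1 < p)%N ->
  p%:R `^ (- an_dist nu p D1 D2) = join_ratio D1 D2.
Proof.
move=> p1; rewrite /an_dist/= radius_disc_join /logp -mulrDl.
have j0 := join_radius_gt0 D1 D2.
rewrite -lnM ?posrE ?divr_gt0 ?radius_gt0//.
have lnp : ln (p%:R : R) != 0 by rewrite gt_eqF// ln_gt0// ltr1n.
rewrite /powR pnatr_eq0 -[p == 0%N]negbK -lt0n (ltn_trans _ p1)//.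
rewrite mulNr divfK// expRN lnK ?posrE ?mulr_gt0 ?invr_gt0 ?radius_gt0//.
rewrite /join_ratio mulf_div invf_div expr2//.
Qed.

Definition apart C1 C2 : Prop :=
  forall x, oball_closed nu C1 x -> oball_closed nu C2 x -> False.

Lemma apartC C1 C2 : apart C1 C2 -> apart C2 C1.
Proof. by move=> h x x2 x1; exact: h x1 x2. Qed.

Lemma apart_InnerInner D1 D2 : apart (Inner D1) (Inner D2) ->
  [/\ radius D1 < nu (D1.1 - D2.1), radius D2 < nu (D1.1 - D2.1)
    & join_radius D1 D2 = nu (D1.1 - D2.1)].
Proof.
move=> h.
have h1 : radius D1 < nu (D1.1 - D2.1).
  rewrite ltNge; apply/negP => h'; apply: (h (Some D2.1)).
    by rewrite oball_closedE nuB.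
  by rewrite oball_closedE subrr nu0// ltW ?radius_gt0.
have h2 : radius D2 < nu (D1.1 - D2.1).
  rewrite ltNge; apply/negP => h'; apply: (h (Some D1.1)); last first.
    by rewrite oball_closedE.
  by rewrite oball_closedE subrr nu0// ltW ?radius_gt0.
split=> //; rewrite /join_radius; apply/max_idPl.
by rewrite ge_max !ltW.
Qed.

(** Avoiding the complement of an open disc means lying inside that disc. The radii may coincide
    when they are not in the value group, hence the weak inequality. *)
Lemma apart_InnerOuter D1 D2 : apart (Inner D1) (Outer D2) ->
  [/\ nu (D1.1 - D2.1) < radius D2, radius D1 <= radius D2
    & join_radius D1 D2 = radius D2].
Proof.
move=> h.
have h1 : nu (D1.1 - D2.1) < radius D2.
  rewrite ltNge; apply/negP => h'; apply: (h (Some D1.1)); rewrite oball_closedE//.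
  by rewrite subrr nu0// ltW ?radius_gt0.
have h2 : radius D1 <= radius D2.
  apply: le_radius => x x1; rewrite /disc_closed/= leNgt; apply/negP => /ltW x2.
  by apply: (h (Some x)); rewrite oball_closedE.
by split=> //; rewrite /join_radius (max_idPr h2); apply/max_idPr/ltW.
Qed.

Lemma join_radiusC D1 D2 : join_radius D1 D2 = join_radius D2 D1.
Proof. by rewrite /join_radius nuB// [X in Num.max _ X]maxC. Qed.

Lemma join_ratioC D1 D2 : join_ratio D1 D2 = join_ratio D2 D1.
Proof. by rewrite /join_ratio join_radiusC [radius D1 * _]mulrC. Qed.

(* In a coordinate mapping [C] to the unit disc: [|u - v| <= rho]. *)
Definition ball_le C (rho : R) u v : Prop :=
  match C with
  | Inner D => bracket nu u v <= rho * radius D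
  | Outer D => radius D * bracket nu u v <=
      rho * (bracket nu u (Some D.1) * bracket nu v (Some D.1))
  end.

Lemma ball_le1 C u v : oball_closed nu C u -> oball_closed nu C v ->
  ball_le C 1 u v.
Proof.
rewrite !oball_closedE; case: C u v => D [u|] [v|] //= hu hv.
- by rewrite mul1r (le_trans (nuB_le nuP _ _ D.1))// ge_max hu (nuB nuP) hv.
- rewrite mul1r /bracket /=.
  have := nuB_le nuP u v D.1; rewrite le_max (nuB nuP D.1) => /orP[] h.
  + by rewrite mulrC ler_pM ?nu_ge0// ltW ?radius_gt0.
  + by rewrite ler_pM ?nu_ge0// ltW ?radius_gt0.
- by rewrite /bracket /= nu1// !mulr1 mul1r.
- by rewrite /bracket /= nu1// mulr1 !mul1r.
- by rewrite /bracket /= nu0// mulr0 nu1// !mulr1.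
Qed.

Lemma nuB_apart (x y t : K) : nu (y - t) < nu (x - t) -> nu (x - y) = nu (x - t).
Proof. by move=> h; apply: nuB_eq => //; rewrite nuB. Qed.

Lemma nuB_apart2 (x y s t : K) : nu (x - s) < nu (s - t) -> nu (y - t) < nu (s - t) ->
  nu (x - y) = nu (s - t).
Proof.
move=> hx hy; rewrite (nuB nuP) (@nuB_apart y x s) ?(nuB nuP y).
  by rewrite (@nuB_apart s y t)//.
by rewrite (@nuB_apart s y t).
Qed.

(** Seen from a point [x] outside the open disc of [D2], all points of that disc are equally far; at
    infinity both brackets are 1. *)
Lemma bracket_InnerOuter D1 D2 y x : apart (Inner D1) (Outer D2) ->
  oball_closed nu (Inner D1) y -> oball_closed nu (Outer D2) x ->
  bracket nu y x = bracket nu x (Some D2.1).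
Proof.
move=> C12 hy hx.
have : ~ oball_closed nu (Outer D2) y by move=> /(C12 _ hy).
move: hx; rewrite !oball_closedE; case: y hy => [y|] _; last by [].
case: x => [x|] // hx /negP; rewrite -ltNge => hy.
rewrite bracketC// /bracket /=.
by rewrite (@nuB_apart x y D2.1)// (lt_le_trans hy).
Qed.

(** For two inner balls both mixed brackets equal the distance of the centres, while |z-w| and |u-v|
    are at most r1 and [rho] r2. If one ball is outer, the mixed brackets become brackets with its
    centre, which match those in [ball_le]. Two outer balls would meet at infinity. *)
Lemma ball_le_cross C1 C2 rho u v : apart C1 C2 -> 0 <= rho ->
  oball_closed nu C2 u -> oball_closed nu C2 v -> ball_le C2 rho u v ->
  cross_le nu (oball_closed nu C1)
    (join_ratio (oball_point C1) (oball_point C2) * rho) u v.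
Proof.
case: C1 C2 => D1 [] D2 C12 rho0 hu hv H z w hz hw; rewrite /join_ratio /oball_point.
- have [h1 h2 ->] := apart_InnerInner C12.
  move: hu hv H hz hw.
  rewrite !oball_closedE; case: u => [u|]//; case: v => [v|]//.
  case: z => [z|]//; case: w => [w|]// hu hv H hz hw.
  rewrite /bracket /=.
  rewrite (nuB_apart2 (le_lt_trans hz h1) (le_lt_trans hv h2)).
  rewrite (nuB_apart2 (le_lt_trans hw h1) (le_lt_trans hu h2)).
  have s0 : 0 < nu (D1.1 - D2.1) by rewrite (lt_trans _ h1)// radius_gt0.
  rewrite -expr2 mulrAC divfK ?gt_eqF ?exprn_gt0// -mulrA ler_pM ?nu_ge0//.
    by rewrite (le_trans (nuB_le nuP _ _ D1.1))// ge_max hz (nuB nuP) hw.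
  by rewrite mulrC.
- have [h1 h2 ->] := apart_InnerOuter C12.
  have r0 := radius_gt0 D2.
  rewrite expr2 -mulf_div divff ?gt_eqF// mulr1.
  rewrite (bracket_InnerOuter C12 hz hv) (bracket_InnerOuter C12 hw hu).
  have zw : bracket nu z w <= radius D1.
    by have := ball_le1 hz hw; rewrite /ball_le mul1r.
  apply: (@le_trans _ _ (radius D1 * bracket nu u v)).
    by rewrite ler_wpM2r ?bracket_ge0.
  rewrite -!mulrA ler_wpM2l ?(ltW (radius_gt0 _))// ler_pdivlMl//.
  by rewrite [X in _ <= _ * X]mulrC.
- have C21 := apartC C12.
  have [h1 h2] := apart_InnerOuter C21; rewrite join_radiusC => ->.
  have r0 := radius_gt0 D1.
  rewrite expr2 -mulf_div divff ?gt_eqF// mul1r.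
  rewrite (bracketC nuP z v) (bracketC nuP w u).
  rewrite (bracket_InnerOuter C21 hv hz) (bracket_InnerOuter C21 hu hw).
  have zw := ball_le1 hz hw; rewrite /ball_le mul1r in zw.
  rewrite -ler_pdivlMl// in zw.
  have := ler_pM (bracket_ge0 nuP _ _) (bracket_ge0 nuP _ _) zw H.
  move=> /le_trans; apply.
  by rewrite le_eqVlt; apply/orP; left; apply/eqP; ring.
- by have := C12 None; rewrite !oball_closedE => /(_ I I).
Qed.

(** A converse obtained by testing on well chosen points outside [C]. For an inner ball take
    infinity and a point at distance slightly above the radius from the centre; for an outer one
    take the centre and a point at distance slightly below the radius. Density of the value group
    then gives the bound with the radius itself. *)
Lemma cross_le_ball C rho u v : 0 <= rho ->
  oball_set nu C u -> oball_set nu C v ->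
  cross_le nu (~` oball_set nu C) rho u v -> ball_le C rho u v.
Proof.
move=> rho0; case: C => D; rewrite !oball_setE => hu hv H.
- case: u hu H => [u|]// hu; case: v hv => [v|]// hv H.
  have r0 := radius_gt0 D.
  rewrite /ball_le leNgt; apply/negP => lt_b.
  have b0 : 0 < bracket nu (Some u) (Some v).
    by rewrite (le_lt_trans _ lt_b)// mulr_ge0// ltW.
  (* A positive substitute for [rho], which may be 0, so that dividing by it is possible. *)
  have [k [k0 lek ltk]] :
      exists k, [/\ 0 < k, rho <= k & k * radius D < bracket nu (Some u) (Some v)].
    move: rho0; rewrite le_eqVlt => /predU1P[<-|rho0]; last by exists rho.
    exists (bracket nu (Some u) (Some v) / 2 / radius D); split.
    - by rewrite !divr_gt0.
    - by rewrite ltW// !divr_gt0.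
    - by rewrite divfK ?gt_eqF// ltr_pdivrMr// mulr_natr mulr2n ltrDl.
  rewrite -ltr_pdivlMl// in ltk.
  have [x /andP[rx]] := nu_dense (ltW r0) ltk.
  rewrite ltr_pdivlMl// ltNge => /negP; apply.
  have out1 : ~ oball_set nu (Inner D) None by rewrite oball_setE.
  have out2 : ~ oball_set nu (Inner D) (Some (x + D.1)).
    by rewrite oball_setE addrK; apply/negP; rewrite -leNgt ltW.
  have := H _ _ out1 out2.
  rewrite /bracket/= nu1// !mul1r => /le_trans; apply.
  apply: ler_pM => //; rewrite ?nu_ge0//.
  rewrite le_eqVlt; apply/orP; left; apply/eqP.
  rewrite -[x in RHS](addrK D.1); apply: nuB_apart; rewrite addrK.
  exact: lt_trans rx.
- have r0 := radius_gt0 D.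
  rewrite /ball_le leNgt; apply/negP => lt_b.
  set M := rho * _ in lt_b.
  have M0 : 0 <= M by rewrite !mulr_ge0// bracket_ge0.
  have b0 : 0 < bracket nu u v.
    by rewrite -(pmulr_rgt0 _ r0) (le_lt_trans _ lt_b).
  rewrite -ltr_pdivrMr// in lt_b.
  have [x /andP[rx xr]] := nu_dense (divr_ge0 M0 (ltW b0)) lt_b.
  move: rx; rewrite ltr_pdivrMr// ltNge => /negP; apply.
  have out1 : ~ oball_set nu (Outer D) (Some (x + D.1)).
    by rewrite oball_setE addrK; apply/negP; rewrite -leNgt ltW.
  have out2 : ~ oball_set nu (Outer D) (Some D.1).
    by rewrite oball_setE subrr nu0//; apply/negP; rewrite -leNgt ltW.
  have := H _ _ out1 out2.
  have -> : bracket nu (Some (x + D.1)) v = bracket nu v (Some D.1).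
    case: v hv {H lt_b b0 M M0} => [v|] // hv.
    rewrite bracketC// /bracket /=.
    by apply: nuB_apart; rewrite addrK (lt_trans xr).
  rewrite (bracketC nuP (Some D.1)) {1}/bracket /= addrK.
  by rewrite [X in rho * X]mulrC.
Qed.

End BallGeometry.

(** * Ping-pong for the letters and contraction along reduced words *)

Section PingPong.
Variables (R : realType) (K : fieldType) (nu : K -> R).
Hypothesis nuP : nonarch_absval nu.
Hypothesis nu_dense : forall r s : R, 0 <= r -> r < s ->
  exists x : K, r < nu x < s.

(** Disjointness alone is not enough: an inner and an outer ball of equal radius outside the value
    group can be disjoint and cover the whole line. The point [a] outside both open balls excludes
    this. *)
Lemma join_ratio_lt1 (C1 C2 : oball R K) a : apart nu C1 C2 ->
  ~ oball_set nu C1 a -> ~ oball_set nu C2 a ->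
  join_ratio nu (oball_point C1) (oball_point C2) < 1.
Proof.
wlog : C1 C2 / match C1, C2 with Outer _, Inner _ => False | _, _ => True end.
  move=> wl; case: C1 C2 => D1 [] D2; try exact: wl.
  by rewrite join_ratioC// => /apartC C21 a1 a2; exact: wl.
case: C1 C2 => D1 [] D2 // _ C12; rewrite /join_ratio /oball_point.
- move=> _ _; have [h1 h2 ->] := apart_InnerInner nuP C12.
  have s0 : 0 < nu (D1.1 - D2.1) by rewrite (lt_trans _ h1)// radius_gt0.
  by rewrite ltr_pdivrMr ?exprn_gt0// mul1r expr2 ltr_pM// ltW// radius_gt0.
- have [h1 h2 ->] := apart_InnerOuter nuP nu_dense C12.
  have r0 := radius_gt0 D2; rewrite !oball_setE; case: a => [t|] // /negP.
  rewrite -leNgt => t1 /negP; rewrite -leNgt => t2.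
  rewrite expr2 -mulf_div divff ?gt_eqF// mulr1 ltr_pdivrMr// mul1r.
  rewrite lt_neqAle h2 andbT; apply/negP => /eqP r12.
  have t1' : nu (t - D1.1) <= radius D1.
    have := nuB_le nuP t D1.1 D2.1; rewrite r12 (nuB nuP D2.1) => /le_trans; apply.
    by rewrite ge_max t2 ltW.
  have : ~ oball_closed nu (Outer D2) (Some t).
    by apply: C12; rewrite oball_closedE.
  rewrite oball_closedE => /negP; rewrite -ltNge => t2'.
  have := nuB_le nuP t D1.1 D2.1; rewrite (nuB nuP D2.1) => /(le_trans t1).
  by rewrite leNgt gt_max r12 t2' h1.
- by have := C12 None; rewrite !oball_closedE => /(_ I I).
Qed.

Variables (g : nat) (gam : 'I_g -> PGL2 K) (B B' : 'I_g -> oball R K).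
Variable F : set (P1 K).
Hypothesis F_good : good_fundamental_domain nu gam B B' F.
Local Notation letter := ('I_g * bool)%type.
Local Notation ball := (all_balls B B').
Local Notation bset l := (oball_set nu (ball l)).
Local Notation bclosed l := (oball_closed nu (ball l)).
Local Notation act l := (mob (letter_val gam l)).
Implicit Types (l : letter) (w : seq letter) (x y z u v a : P1 K).

Definition letterV l : letter := (l.1, ~~ l.2).

Lemma letterVK : involutive letterV.
Proof. by case=> i b; rewrite /letterV /= negbK. Qed.

Lemma letter_valV l : letter_val gam (letterV l) = (letter_val gam l)^-1%g.
Proof. by case: l => i []; rewrite /letter_val //= invgK. Qed.

Lemma ball_apart l l' : l != l' -> apart nu (ball l) (ball l').
Proof.
move=> ll' x xl xl'; case: F_good => _ triv _ _.
by case/eqP: ll'; apply: (triv l l' I I); exists x.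
Qed.

Lemma act_image l : act l @` (~` bset (letterV l)) = bclosed l.
Proof. by case: F_good => _ _ h h'; case: l => i []; [exact: h'|exact: h]. Qed.

Lemma act_out l x : ~ bset (letterV l) x -> bclosed l (act l x).
Proof. by move=> xl; rewrite -act_image; exists x. Qed.

Lemma actV l x : act (letterV l) (act l x) = x.
Proof. by rewrite letter_valV mobK. Qed.

Lemma act_in l x : ~ bclosed (letterV l) x -> bset l (act l x).
Proof.
move=> h; apply: contrapT => h'; apply: h.
by rewrite -[x](actV l); apply: act_out; rewrite letterVK.
Qed.

Lemma act_closed l x : bclosed (letterV l) x -> ~ bset l (act l x).
Proof.
rewrite -act_image letterVK => -[y yl <-].
by have := actV (letterV l) y; rewrite letterVK => ->.
Qed.

Lemma act_preimage l z : ~ bset l z -> exists2 x, bclosed (letterV l) x & act l x = z.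
Proof.
move=> zl; exists (act (letterV l) z); last by rewrite -{1}(letterVK l) actV.
by apply: act_out; rewrite letterVK.
Qed.

Lemma F_out l x : F x -> ~ bset l x.
Proof. by case: F_good => -> _ _ _ Fx lx; apply: Fx; exists l. Qed.

Lemma boundary_F l x : bclosed l x -> ~ bset l x -> F x.
Proof.
case: F_good => -> _ _ _ lx lx' [l' _ l'x].
have [l'l|/ball_apart] := eqVneq l' l; first by rewrite l'l in l'x.
by move=> /(_ x); apply => //; exact: oball_set_closed.
Qed.

Lemma word_val_cons l w : word_val gam (l :: w) = (letter_val gam l * word_val gam w)%g.
Proof. by rewrite /word_val big_cons. Qed.

Lemma reduced_cons2 l l' w :
  reduced [:: l, l' & w] = (letterV l != l') && reduced (l' :: w).
Proof. by rewrite /reduced /= (can2_eq letterVK letterVK). Qed.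

(** The image under the tail lies in the ball of the next letter, which is not the inverse of [l],
    so [l] sends it into its own ball. A single letter reaches only the closed ball, because [x] may
    be a boundary point of [F]; from two letters on the image is in the open ball. *)
Lemma word_closed l w x : reduced (l :: w) -> F x ->
  bclosed l (mob (word_val gam (l :: w)) x).
Proof.
elim: w l => [|l' w IH] l; rewrite word_val_cons mobM.
  by move=> _ Fx; rewrite /word_val big_nil mob1; apply: act_out; exact: F_out.
rewrite reduced_cons2 => /andP[ll' rw] Fx; apply/oball_set_closed/act_in => h.
by apply: (ball_apart ll' h); exact: IH.
Qed.

Lemma word_open l l' w x : reduced [:: l, l' & w] -> F x ->
  bset l (mob (word_val gam [:: l, l' & w]) x).
Proof.
rewrite reduced_cons2 => /andP[ll' rw] Fx.
rewrite word_val_cons mobM; apply: act_in => h.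
by apply: (ball_apart ll' h); exact: word_closed.
Qed.

(** Length at least 2 puts the image of [a] in an open ball, which misses [z]. The letter [gam i]
    sends [a] to the closed ball of (i, false), disjoint from that of (j, true); any other single
    letter sends [a] into an open ball. *)
Lemma word_act_neq w i j a z : reduced w ->
  bclosed (i, true) a -> ~ bset (i, true) a ->
  bclosed (j, true) z -> ~ bset (j, true) z -> a <> z ->
  mob (word_val gam w) a <> z.
Proof.
case: w => [|l [|l' w]] rw ca a_out cz z_out az.
- by rewrite /word_val big_nil mob1.
- rewrite word_val_cons /word_val big_nil mulg1 => la.
  have [Vl|Vl] := eqVneq (letterV l) (i, true).
    have lE : l = (i, false) by rewrite -[l]letterVK Vl.
    have ij : l != (j, true) by rewrite lE xpair_eqE andbF.
    apply: (ball_apart ij _ cz); rewrite -la; apply: act_out.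
    by rewrite Vl.
  apply: (@F_out l z (boundary_F cz z_out)); rewrite -la; apply: act_in => h.
  by apply: (ball_apart Vl h ca).
- move=> la; apply: (@F_out l z (boundary_F cz z_out)); rewrite -la.
  exact: word_open rw (boundary_F ca a_out).
Qed.

Variable q : R.
Hypothesis q_ge : forall l l', l != l' ->
  join_ratio nu (oball_point (ball l)) (oball_point (ball l')) <= q.
Hypothesis q_ge0 : 0 <= q.

Lemma cross_leW S (rho rho' : R) u v : rho <= rho' ->
  cross_le nu S rho u v -> cross_le nu S rho' u v.
Proof.
move=> le_rho H z w Sz Sw; apply: le_trans (H z w Sz Sw) _.
by rewrite ler_wpM2r// mulr_ge0 ?bracket_ge0.
Qed.

(* Two disjoint balls contribute a factor [q], and the letter [l] moves the
   estimate from its source ball to its target ball. *)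
Lemma cross_le_step l l' rho u v : letterV l != l' -> 0 <= rho ->
  bclosed l' u -> bclosed l' v -> ball_le nu (ball l') rho u v ->
  cross_le nu (~` bset l) (q * rho) (act l u) (act l v).
Proof.
move=> ll' rho0 hu hv H.
have sub : ~` bset l `<=` act l @` bclosed (letterV l).
  by move=> z /act_preimage[x hx <-]; exists x.
have H' : cross_le nu (bclosed (letterV l)) (q * rho) u v.
  apply: (@cross_leW _ _ _ _ _ (ler_wpM2r rho0 (q_ge ll'))).
  by apply: ball_le_cross => //; exact: ball_apart.
by move=> z w /sub lz /sub lw; exact: (cross_le_mob nuP H').
Qed.

(** Each new letter turns a bound inside the ball of [l'] into a cross ratio bound outside the ball
    of [l], with an extra factor [q]; [cross_le_ball] converts this back into a bound inside the
    ball of [l]. *)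
Lemma word_ball_le l w u v : reduced (l :: w) -> F u -> F v ->
  ball_le nu (ball l) (q ^+ size w)
    (mob (word_val gam (l :: w)) u) (mob (word_val gam (l :: w)) v).
Proof.
move=> + Fu Fv; elim: w l => [|l' w IH] l rw.
  by rewrite expr0; apply: ball_le1 => //; exact: word_closed.
apply: cross_le_ball; rewrite ?exprn_ge0//; [exact: word_open..|].
move: rw; rewrite reduced_cons2 => /andP[ll' rw].
rewrite word_val_cons !mobM exprS; apply: (cross_le_step ll'); rewrite ?exprn_ge0//.
- exact: word_closed.
- exact: word_closed.
- exact: IH.
Qed.

(** The last step is left as a cross ratio bound, since [z] and [w] range outside the ball of [l].
    The exponent is the word length minus one. *)
Lemma word_cross_le l l' w u v : reduced [:: l, l' & w] -> F u -> F v ->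
  cross_le nu (~` bset l) (q ^+ (size w).+1)
    (mob (word_val gam [:: l, l' & w]) u) (mob (word_val gam [:: l, l' & w]) v).
Proof.
rewrite reduced_cons2 => /andP[ll' rw] Fu Fv.
rewrite word_val_cons !mobM exprS; apply: (cross_le_step ll'); rewrite ?exprn_ge0//.
- exact: word_closed.
- exact: word_closed.
- exact: word_ball_le.
Qed.

(** The images lie in the open ball of the first letter, which misses [F], so the mixed brackets are
    positive and can be divided out. *)
Lemma cross_ratio_word w z z' u v : reduced w -> (1 < size w)%N ->
  F z -> F z' -> F u -> F v ->
  nu (cross_ratio z z' (mob (word_val gam w) u) (mob (word_val gam w) v) - 1)
    <= q ^+ (size w).-1.
Proof.
case: w => [|l [|l' w]] // rw _ Fz Fz' Fu Fv.
have zl x y : F x -> F y -> x != mob (word_val gam [:: l, l' & w]) y.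
  by move=> Fx Fy; apply/eqP => xy; apply: (@F_out l _ Fx); rewrite xy; exact: word_open.
have zv := zl _ _ Fz Fv; have z'u := zl _ _ Fz' Fu.
rewrite -(ler_pM2r (x := bracket nu z (mob (word_val gam [:: l, l' & w]) v) *
  bracket nu z' (mob (word_val gam [:: l, l' & w]) u))); last first.
  by rewrite mulr_gt0// bracket_gt0.
rewrite nu_cross_ratio_sub1//.
by apply: word_cross_le => //; exact: F_out.
Qed.

End PingPong.

(** * Reduced words and the subgroup they generate *)

Section ReducedWords.
Variables (K : fieldType) (g : nat) (gam : 'I_g -> PGL2 K).
Local Notation letter := ('I_g * bool)%type.
Implicit Types (l : letter) (w : seq letter).

Lemma word_val_cat w w' :
  word_val gam (w ++ w') = (word_val gam w * word_val gam w')%g.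
Proof. by rewrite /word_val big_cat. Qed.

Lemma word_valV w : (word_val gam w)^-1%g = word_val gam (rev (map (@letterV g) w)).
Proof.
elim: w => [|l w IH]; first by rewrite /word_val !big_nil invg1.
rewrite word_val_cons invgM IH /= rev_cons -cats1 word_val_cat.
by rewrite /word_val big_seq1 letter_valV.
Qed.

(** Letters are added on the left of a word already reduced, so each causes at most one
    cancellation. *)
Lemma word_val_reduced w :
  exists2 w', reduced w' & word_val gam w' = word_val gam w.
Proof.
elim: w => [|l w [w' rw' ww']]; first by exists [::].
rewrite word_val_cons -ww'; case: w' rw' {ww'} => [|l' w'] rw'.
  by exists [:: l]; rewrite // word_val_cons.
have [ll'|ll'] := eqVneq (letterV l) l'.
  exists w'; first exact: path_sorted rw'.
  by rewrite word_val_cons -ll' letter_valV mulgA mulgV mul1g.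
by exists [:: l, l' & w']; rewrite ?reduced_cons2 ?ll' ?word_val_cons.
Qed.

Lemma word_val_smallest w :
  smallest (@subgroup_set K) (range gam) (word_val gam w).
Proof.
move=> H [[H1 HD] Hgam].
(* [HD] is closure under x y^-1; inverses and products are recovered from it. *)
have HV x : H x -> H x^-1%g.
  by move=> Hx; rewrite -[(x^-1)%g]mul1g; apply: set_mem; apply: HD => //; exact: mem_set.
have HM x y : H x -> H y -> H (x * y)%g.
  move=> Hx Hy; rewrite -[y]invgK; apply: set_mem.
  by apply: HD; apply: mem_set => //; exact: HV.
elim: w => [|[k b] w IH]; first by rewrite /word_val big_nil; exact: set_mem.
rewrite word_val_cons; apply: HM => //.
by case: b; rewrite /letter_val /=; [apply: HV|]; apply: Hgam; exists k.
Qed.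

Lemma smallest_subgroup_word h :
  smallest (@subgroup_set K) (range gam) h ->
  exists2 w, reduced w & word_val gam w = h.
Proof.
suff : smallest (@subgroup_set K) (range gam) `<=`
    [set h | exists w, word_val gam w = h].
  by move=> /[apply] -[w <-]; exact: word_val_reduced.
apply: smallest_sub => [|_ [i _ <-]].
  split; first by apply: mem_set; exists [::]; rewrite /word_val big_nil.
  move=> _ _ /set_mem[w <-] /set_mem[w' <-]; apply: mem_set.
  by exists (w ++ rev (map (@letterV g) w')); rewrite word_val_cat -word_valV.
by exists [:: (i, false)]; rewrite /word_val big_seq1.
Qed.

Lemma word_ball_finite n : finite_set (word_ball gam n).
Proof.
elim: n => [|n IH].
  apply: (@sub_finite_set _ _ [set 1%g]); last exact: finite_set1.
  by move=> _ [w [_ + <-]]; case: w => //; rewrite /word_val big_nil.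
apply: (@sub_finite_set _ _ ([set 1%g] `|`
  [set (letter_val gam l * h)%g | l in setT & h in word_ball gam n])).
  move=> _ [[|l w] [rw sw <-]]; first by left; rewrite /word_val big_nil.
  right; exists l => //; exists (word_val gam w); last by rewrite word_val_cons.
  by exists w; split=> //; exact: path_sorted rw.
rewrite finite_setU; split; first exact: finite_set1.
exact: finite_image2 finite_finset IH.
Qed.

End ReducedWords.

(** * Unconditional products whose factors tend to 1 *)

Section InfiniteProduct.
Variables (R : realType) (K : fieldType) (nu : K -> R).
Hypothesis nuP : nonarch_absval nu.

(** For [e <= 1] the closed disc of radius [e] about 1 is stable under multiplication. *)
Lemma nu_prod_sub1 (T : eqType) (s : seq T) (P : pred T) (f : T -> K) (e : R) :
  0 <= e <= 1 -> (forall x, x \in s -> P x -> nu (f x - 1) <= e) ->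
  nu (\prod_(x <- s | P x) f x - 1) <= e.
Proof.
move=> /andP[e0 e1]; elim: s => [|x s IH] H; first by rewrite big_nil subrr nu0.
have {}IH : nu (\prod_(x <- s | P x) f x - 1) <= e.
  by apply: IH => y ys; apply: H; rewrite in_cons ys orbT.
rewrite big_cons; case: ifP => // Px; move: IH; set M := \prod_(_ <- _ | _) _ => IH.
have M1 : nu M <= 1.
  have := nuD_le nuP (M - 1) 1; rewrite subrK nu1// => /le_trans; apply.
  by rewrite ge_max lexx (le_trans IH e1).
have -> : f x * M - 1 = (f x - 1) * M + (M - 1) by ring.
apply: le_trans (nuD_le nuP _ _) _; rewrite ge_max IH andbT nuM//.
by rewrite -[leRHS]mulr1 ler_pM ?nu_ge0// H// mem_head.
Qed.

Variables (T : choiceType) (A : set T) (f : T -> K) (S : nat -> {fset T}) (q : R).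
Hypothesis q01 : 0 <= q < 1.
Hypothesis S_sub : forall n, [set` S n] `<=` A.
Hypothesis S_mono : forall m n, (m <= n)%N -> [set` S m] `<=` [set` S n].
Hypothesis f_near1 : forall n x, (1 <= n)%N -> A x -> x \notin S n ->
  nu (f x - 1) <= q ^+ n.
Let P n := \prod_(x <- S n) f x.

Lemma prod_fset_split (S0 S' : {fset T}) : [set` S0] `<=` [set` S'] ->
  \prod_(x <- S') f x =
    (\prod_(x <- S0) f x) * \prod_(x <- S' | x \notin S0) f x.
Proof.
move=> sub; rewrite (bigID (fun x => x \in S0)) /=; congr (_ * _).
rewrite -big_filter; apply: perm_big; apply: uniq_perm.
- by rewrite filter_uniq// fset_uniq.
- exact: fset_uniq.
- by move=> x; rewrite mem_filter andb_idr// => /sub.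
Qed.

Lemma nu_prod_sub n (S' : {fset T}) : (1 <= n)%N ->
  [set` S n] `<=` [set` S'] -> [set` S'] `<=` A ->
  nu (\prod_(x <- S') f x - P n) <= nu (P n) * q ^+ n.
Proof.
move=> n1 sub S'A; rewrite (prod_fset_split sub) -/(P n).
rewrite -{2}[P n]mulr1 -mulrBr nuM// ler_wpM2l ?nu_ge0//.
move/andP: q01 => [q0 /ltW q1].
apply: nu_prod_sub1; first by rewrite exprn_ge0// exprn_ile1.
by move=> x xS' xn; apply: f_near1 => //; exact: S'A.
Qed.

(** Compare [l] with a finite product over a set containing both [S n] and a set good for the
    tolerance [nu (P n) * q ^+ n]; by the ultrametric inequality nothing is lost. The assumptions
    make this tolerance positive. *)
Lemma has_prod_near l n : (1 <= n)%N -> P n != 0 -> 0 < q -> has_prod nu A f l ->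
  nu (l - P n) <= nu (P n) * q ^+ n.
Proof.
move=> n1 Pn0 q0 hl.
have [|S0 S0A H] := hl (nu (P n) * q ^+ n).
  by rewrite mulr_gt0 ?exprn_gt0 ?nu_gt0.
pose S' := (S0 `|` S n)%fset.
have S0S' : [set` S0] `<=` [set` S'] by move=> x /= xS; rewrite in_fsetU xS.
have SnS' : [set` S n] `<=` [set` S'] by move=> x /= xS; rewrite in_fsetU xS orbT.
have S'A : [set` S'] `<=` A.
  by move=> x /=; rewrite in_fsetU => /orP[/S0A|/S_sub].
apply: le_trans (nuB_le nuP _ _ (\prod_(x <- S') f x)) _.
by rewrite ge_max nu_prod_sub// (nuB nuP) ltW// H.
Qed.

(** The products [P n] are bounded by [P 1], so the relative errors q^n become absolute ones and [P]
    is Cauchy. Its limit is unconditional because the tail estimate holds for every finite set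
    containing [S N]. *)
Lemma has_prod_exists : abs_complete nu -> exists l, has_prod nu A f l.
Proof.
move=> complete; move/andP: (q01) => [q0 q1].
have Sn1 n : (1 <= n)%N -> nu (P n) <= nu (P 1%N).
  move=> n1.
  have := @nu_prod_sub 1%N (S n) isT (S_mono n1) (@S_sub n).
  rewrite -/(P n) expr1 => h.
  have := nuD_le nuP (P n - P 1%N) (P 1%N); rewrite subrK => /le_trans; apply.
  by rewrite ge_max lexx andbT (le_trans h)// ler_piMr ?nu_ge0// ltW.
have small e : 0 < e -> exists2 N, (1 <= N)%N &
    forall S' : {fset T}, [set` S N] `<=` [set` S'] ->
    [set` S'] `<=` A -> nu (\prod_(x <- S') f x - P N) < e.
  (* Adding 1 allows division even if [P 1] vanishes. *)
  move=> e0; have c0 : 0 < nu (P 1%N) + 1 by rewrite ltr_wpDl ?nu_ge0.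
  have [N hN] := @exprn_lt_small R q (e / (nu (P 1%N) + 1)) q0 q1 (divr_gt0 e0 c0).
  exists N.+1 => // S' sub S'A; apply: le_lt_trans (nu_prod_sub _ sub S'A) _ => //.
  move: hN; rewrite ltr_pdivlMr//; apply: le_lt_trans.
  have PN : nu (P N.+1) <= nu (P 1%N) + 1 by rewrite (le_trans (Sn1 _ _))// lerDl.
  have qN : q ^+ N.+1 <= q ^+ N by rewrite exprS ler_piMl ?exprn_ge0// ltW.
  by rewrite [leRHS]mulrC ler_pM ?(nu_ge0 nuP) ?exprn_ge0.
have [l hl] : exists l, abs_cvg nu P l.
  apply: complete => e e0; have [N N1 HN] := small e e0.
  exists N => m n Nm Nn; apply: le_lt_trans (nuB_le nuP _ _ (P N)) _.
  by rewrite gt_max (nuB nuP (P N)) !HN//; exact: S_mono.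
exists l => e e0; have [N N1 HN] := small e e0; have [M HM] := hl e e0.
exists (S N) => // S' sub S'A.
apply: le_lt_trans (nuB_le nuP _ _ (P N)) _; rewrite gt_max HN//=.
apply: le_lt_trans (nuB_le nuP _ _ (P (maxn M N))) _.
rewrite gt_max HM ?leq_maxl// andbT (nuB nuP) HN//.
by apply: S_mono; rewrite leq_maxr.
Qed.

End InfiniteProduct.

(** * Comparison of the truncated theta quotient with the full one *)

Theorem theorem3p6 (R : realType) (p : nat) (p_prime : prime p)
    (K : fieldType) (nu : K -> R) (K_Cp : is_Cp p nu)
    (Gam : set (PGL2 K)) (Gam_schottky : schottky nu Gam)
    (g : nat) (gam : 'I_g -> PGL2 K) (gam_free : free_generators gam Gam)
    (B B' : 'I_g -> oball R K) (F : set (P1 K))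
    (F_good : good_fundamental_domain nu gam B B' F)
    (c : R) (c_min : smallest_distance nu B B' p c)
    (m : nat) (m_ge1 : (1 <= m)%N) (i j : 'I_g) (a z : P1 K)
    (ha : (oball_closed nu (B' i) `\` oball_set nu (B' i)) a)
    (hz : (oball_closed nu (B' j) `\` oball_set nu (B' j)) z)
    (a_neq_z : a <> z) :
  nu (theta_quot_trunc gam m i j a z
      / theta_quot nu Gam (gam i) (gam j) a z - 1)
  <= p%:R `^ (- (c * m%:R)).
Proof.
have nuP := Cp_absval K_Cp.
have nu_dense := Cp_absval_dense p_prime K_Cp.
have p1 := prime_gt1 p_prime.
move: ha hz => [ca a_out] [cz z_out].
have Fa : F a by exact: (@boundary_F _ _ _ _ _ _ _ _ F_good (i, true)).
have Fz : F z by exact: (@boundary_F _ _ _ _ _ _ _ _ F_good (j, true)).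
(* [gam k] carries the boundary of B'_k into that of B_k, so [gam i a] and [gam j z] lie in [F]
   too. *)
have gaF k x : oball_closed nu (B' k) x -> ~ oball_set nu (B' k) x ->
    F (mob (gam k) x).
  move=> cx x_out; apply: (@boundary_F _ _ _ _ _ _ _ _ F_good (k, false)).
    exact: (@act_out _ _ _ _ _ _ _ _ F_good (k, false)).
  exact: (@act_closed _ _ _ _ _ _ _ _ F_good (k, false)).
set q := p%:R `^ (- c) : R.
have q0 : 0 < q by rewrite powR_gt0// ltr0n prime_gt0.
have qm : p%:R `^ (- (c * m%:R)) = q ^+ m.
  by rewrite -mulNr powRrM powR_mulrn// ltW.
have q_ge s t : s != t ->
    join_ratio nu (oball_point (all_balls B B' s)) (oball_point (all_balls B B' t)) <= q.
  move=> st; rewrite -(powR_an_dist nuP nu_dense _ _ p1) ler_powR ?ler1n ?prime_gt0//.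
  by rewrite lerN2; case: c_min => _; exact.
(* The minimum [c] is attained at some pair of balls, and [a], being in [F], lies outside both of
   them. *)
have q1 : q < 1.
  case: c_min => -[s [t [st cE]]] _.
  rewrite /q cE (powR_an_dist nuP nu_dense _ _ p1).
  apply: (join_ratio_lt1 nuP nu_dense (a := a)).
  - exact: (ball_apart F_good).
  - exact: (F_out F_good).
  - exact: (F_out F_good).
have [GamE _] := gam_free.
have word h : Gam h -> exists2 w, reduced w & word_val gam w = h.
  by rewrite GamE => /smallest_subgroup_word.
pose f := theta_factor (gam i) (gam j) a z.
pose S n := fset_set (word_ball gam n).
have SE n : [set` S n] = word_ball gam n by rewrite fset_setK//; exact: word_ball_finite.
(* Finiteness of the word ball ensures that the big product is the actual product and not the
   default 1. *)
rewrite /theta_quot_trunc fsbig_finite; last exact: word_ball_finite.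
rewrite -/f -/(S m) /theta_quot /inf_prod -/f qm.
(* If one of the four differences in the cross ratio vanished, moving [gam i] and [gam j] into the
   word would give a word sending [a] to [z]. *)
have f_neq0 h : Gam h -> f h != 0.
  move=> /word[w _ <-].
  have orbit w' : mob (word_val gam w') a <> z.
    have [w1 rw1 <-] := word_val_reduced gam w'.
    exact: (word_act_neq F_good (i := i) (j := j) rw1 ca a_out cz z_out).
  have gE k : gam k = word_val gam [:: (k, false)] by rewrite /word_val big_seq1.
  have zVE k x y : mob (gam k) x = y -> x = mob (word_val gam [:: (k, true)]) y.
    by move=> <-; rewrite /word_val big_seq1 mobK.
  rewrite /f /theta_factor /cross_ratio !mulf_neq0 ?invr_eq0 ?mulf_neq0 ?P1_sub_eq0//.
  - by apply/eqP => zE; apply: (orbit w).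
  - apply/eqP => /zVE; rewrite gE -!mobM -!word_val_cat => zE.
    exact: (orbit _ (esym zE)).
  - apply/eqP => zE; apply: (orbit (w ++ [:: (i, false)])).
    by rewrite word_val_cat mobM -gE.
  - apply/eqP => /zVE; rewrite -!mobM -!word_val_cat => zE.
    exact: (orbit _ (esym zE)).
have S_mono n n' : (n <= n')%N -> [set` S n] `<=` [set` S n'].
  move=> nn'; rewrite !SE => h [w [rw sw wh]]; exists w; split=> //.
  exact: leq_trans nn'.
have S_sub n : [set` S n] `<=` Gam.
  rewrite SE GamE => _ [w [_ _ <-]]; exact: word_val_smallest.
(* Outside Gamma_n a reduced word has length at least n + 1, hence at least 2, and the exponent
   length minus one is at least n. *)
have f_near1 n h : (1 <= n)%N -> Gam h -> h \notin S n -> nu (f h - 1) <= q ^+ n.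
  move=> n1 /word[w rw <-] wS.
  have sw : (n < size w)%N.
    rewrite ltnNge; apply: contra wS => sw.
    rewrite in_fset_set; last exact: word_ball_finite.
    by apply: mem_set; exists w.
  apply: le_trans (cross_ratio_word nuP nu_dense F_good q_ge (ltW q0) rw _ Fz _ Fa _) _.
  - exact: leq_ltn_trans sw.
  - exact: gaF.
  - exact: gaF.
  - rewrite ler_wiXn2l ?(ltW q0) ?(ltW q1)//.
    by rewrite -ltnS (ltn_predK sw).
have q01 : 0 <= q < 1 by rewrite q1 ltW.
(* The product converges, so [inf_prod] is a true limit and not its default 0. *)
have := xgetPex 0 (has_prod_exists nuP q01 S_sub S_mono f_near1 (Cp_complete K_Cp)).
set l := xget _ _; set P := \prod_(_ <- _) _ => hl.
have P0 : P != 0.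
  rewrite /P prodf_seq_neq0; apply/allP => h hS /=; apply: f_neq0.
  by apply: (S_sub m).
have lP : nu (l - P) <= nu P * q ^+ m.
  exact: (has_prod_near nuP q01 S_sub f_near1).
have qm1 : q ^+ m < 1 by rewrite exprn_ilt1 ?ltW// -lt0n.
(* The error is strictly smaller than |P|, so |l| = |P|: [l] is nonzero and the error relative to
   [l] equals that relative to [P]. *)
have nul : nu l = nu P.
  have := @nuD_eq _ _ _ nuP P (l - P); rewrite [P + _]addrC subrK; apply.
  by apply: le_lt_trans lP _; rewrite gtr_pMr ?nu_gt0.
have l0 : l != 0 by rewrite -(nu_eq0 nuP) nul (nu_eq0 nuP).
have -> : P / l - 1 = (P - l) / l by rewrite mulrBl divff.
by rewrite nuM// nuV// nul (nuB nuP) ler_pdivrMr ?nu_gt0// mulrC.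
Qed.
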